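(* Let $d\ge 2$ and let $k\ge 1$ be an integer with $k\le \tau'(d)$, where $\tau'(d)$ is the strict kissing number of $\mathbb{R}^d$. Then $\alpha_{k,d}>0$, where $\alpha_{k,d}$ is the constant such that the number $\Lambda_k(\mathcal{X}_n)$ of vertices of degree $k$ in the minimum spanning tree of $n$ independent uniformly random points of $[0,1]^d$ satisfies $\Lambda_k(\mathcal{X}_n)/n\to\alpha_{k,d}$ almost surely as $n\to\infty$.
   Context: Let $x_1,x_2,\dots$ be independent uniformly random points of $[0,1]^d$ and $\mathcal{X}_n=\{x_1,\dots,x_n\}$. The minimum spanning tree of $\mathcal{X}_n$ is the spanning tree on vertex set $\mathcal{X}_n$ of minimum total Euclidean edge length (almost surely unique). $\Lambda_k(\mathcal{X}_n)$ is the number of vertices of degree $k$ in it. It is a known result (Steele, Shepp, Eddy) that the constants $\alpha_{k,d}$ exist. The strict kissing number $\tau'(d)$ is the maximum $K$ such that there exist $\varepsilon>0$ and a configuration in $\mathbb{R}^d$ of $K$ disjoint spheres of radius $1+\varepsilon$, each tangent to a common unit sphere. *)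

(* Defs.v *)
From HB Require Import structures.
From mathcomp Require Import all_boot all_order all_algebra finmap.
From mathcomp Require Import all_classical all_reals all_analysis.

Set Implicit Arguments.
Unset Strict Implicit.
Unset Printing Implicit Defensive.

Import Order.TTheory GRing.Theory Num.Theory.
Import numFieldNormedType.Exports.
Local Open Scope classical_set_scope.
Local Open Scope ring_scope.

(* Points of R^d are d.-tuple R, which carries the product (= Borel)
   sigma-algebra.  The library norm on R^d is the sup norm, hence this one. *)
Definition edist (R : realType) (d : nat) (p q : d.-tuple R) : R :=
  Num.sqrt (\sum_(j < d) (tnth p j - tnth q j) ^+ 2).

(* A simple graph on a finite type V is given by its edge set, a set of
   2-element sets of vertices. *)
Definition adj (V : finType) (E : {set {set V}}) : rel V :=
  fun u v => (u != v) && ([set u; v]%SET \in E).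

Definition degree (V : finType) (E : {set {set V}}) (v : V) : nat :=
  #|[set u | adj E v u]%SET|.

Definition connected_graph (V : finType) (E : {set {set V}}) : Prop :=
  forall u v : V, connect (adj E) u v.

(* By symmetry of adj, every edge is a ucycle of length 2, so only the cycles
   with at least 3 vertices are excluded. *)
Definition acyclic_graph (V : finType) (E : {set {set V}}) : Prop :=
  forall c : seq V, (2 < size c)%N -> ~ ucycle (adj E) c.

Definition spanning_tree (V : finType) (E : {set {set V}}) : Prop :=
  [/\ forall e, e \in E -> #|e| = 2%N, connected_graph E & acyclic_graph E].

Definition total_length (R : realType) (d n : nat) (x : 'I_n -> d.-tuple R)
    (E : {set {set 'I_n}}) : R :=
  \sum_(i < n) \sum_(j < n | (i < j)%N && adj E i j) edist (x i) (x j).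

Definition is_mst (R : realType) (d n : nat) (x : 'I_n -> d.-tuple R)
    (E : {set {set 'I_n}}) : Prop :=
  spanning_tree E /\
  forall F : {set {set 'I_n}}, spanning_tree F ->
    total_length x E <= total_length x F.

(* In case of ties an arbitrary minimum spanning tree is selected. *)
Definition mst (R : realType) (d n : nat) (x : 'I_n -> d.-tuple R) :
    {set {set 'I_n}} :=
  xget finset.set0 [set E | is_mst x E].

Definition Lambda (R : realType) (d k n : nat) (x : 'I_n -> d.-tuple R) : nat :=
  #|[set v | degree (mst x) v == k]%SET|.

Definition mutually_independent (R : realType) (dT dU : measure_display)
    (T : measurableType dT) (U : measurableType dU) (P : probability T R)
    (X : nat -> {RV P >-> U}) : Prop :=
  forall (J : {fset nat}) (A : nat -> set U),
    (forall i, measurable (A i)) ->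
    P (\bigcap_(i in [set` J]) (X i @^-1` A i)) =
      (\prod_(i <- J) P (X i @^-1` A i))%E.

(* The law of X is the uniform distribution on [0,1]^d, that is, the d-fold
   product of the uniform distribution on [0,1]: the unique probability with
   these values on measurable rectangles. *)
Definition uniform_on_cube (R : realType) (d : nat) (dT : measure_display)
    (T : measurableType dT) (P : probability T R)
    (X : {RV P >-> d.-tuple R}) : Prop :=
  forall A : 'I_d -> set R, (forall j, measurable (A j)) ->
    distribution P X [set t : d.-tuple R | forall j, A j (tnth t j)] =
      (\prod_(j < d) uniform_prob (@ltr01 R) (A j))%E.

Definition esphere (R : realType) (d : nat) (c : d.-tuple R) (r : R) :
    set (d.-tuple R) :=
  [set p | edist c p = r].

(* A sphere internally tangent to the unit sphere is not excluded here; if e > 0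
   and d > 1 it would enclose the unit ball and so could not be disjoint from any
   other sphere of the configuration, so this does not affect the maximum. *)
Definition tangent (T : Type) (S1 S2 : set T) : Prop :=
  exists p, S1 `&` S2 = [set p].

Definition strict_kissing_configuration (R : realType) (d K : nat) : Prop :=
  exists (e : R) (o : d.-tuple R) (c : 'I_K -> d.-tuple R),
    [/\ 0 < e,
        forall i, tangent (esphere o 1) (esphere (c i) (1 + e)) &
        forall i j, i != j ->
          esphere (c i) (1 + e) `&` esphere (c j) (1 + e) = set0].

(* The maximum K for which a configuration exists; the default 0 would be used
   only if there were no maximum. *)
Definition strict_kissing_number (R : realType) (d : nat) : nat :=
  xget 0%N [set K | strict_kissing_configuration R d K /\
    forall L, strict_kissing_configuration R d L -> (L <= K)%N].

(* Main.v *)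
(* In a grid of [n = N^d] cells, each cell contains, with probability bounded
   below and up to scaling, exactly a fixed finite pattern: a centre at the
   origin, [k] unit vectors [u_i] at mutual distances greater than 1 (given by
   the strict kissing configuration), and a shield, i.e. a walk that starts at
   [u_0], moves away from the origin by steps [p -> q] with [|q - p| < |q|],
   and meets every half-axis.  Whatever the points outside the cell are, the
   centre then has degree exactly [k] in the minimum spanning tree.  Each edge
   to [u_i] is the unique shortest edge across a cut.  Any other point [w] is
   joined to the centre by a path of edges shorter than the distance from the
   centre to [w]: along the walk if [w] belongs to the shield, and through a
   shield point on the half-axis nearest to [w] if [w] is outside the cell.

   Hence the expectation of [Lambda k / n] is at least a positive constant along
   [n = N^d], and dominated convergence excludes [alpha <= 0].  No
   measurability of [Lambda] is needed: it is bounded below by the number of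
   cells containing the pattern, which is measurable. *)

Require Import Defs.
From HB Require Import structures.
From mathcomp Require Import all_boot all_order all_algebra finmap.
From mathcomp Require Import all_classical all_reals all_analysis.
From mathcomp Require Import measurable_realfun.
From mathcomp Require Import ring lra zify.

Set Implicit Arguments.
Unset Strict Implicit.
Unset Printing Implicit Defensive.

Import Order.TTheory GRing.Theory Num.Theory.
Import numFieldNormedType.Exports.
Local Open Scope classical_set_scope.
Local Open Scope ring_scope.

(* [all_analysis] exports another [edist]. *)
Local Notation edist := Defs.edist.

(** * Minimum spanning trees *)

Lemma adj_sym (V : finType) (E : {set {set V}}) : symmetric (adj E).
Proof. by move=> a b; rewrite /adj eq_sym finset.setUC. Qed.

Lemma connect_adj_sym (V : finType) (E : {set {set V}}) :
  connect_sym (adj E).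
Proof. exact/sym_connect_sym/adj_sym. Qed.

Lemma set2_eq (V : finType) (a b u v : V) :
  ([set u; v] == [set a; b])%SET =
  ((u == a) && (v == b)) || ((u == b) && (v == a)).
Proof.
apply/eqP/orP => [euv|[]/andP[/eqP-> /eqP->] //]; last by rewrite finset.setUC.
have := finset.set21 u v; rewrite euv finset.in_set2 => /orP[]/eqP eu; subst u.
- have := finset.set22 a v; rewrite euv finset.in_set2 => /orP[]/eqP ev; subst v.
    have := finset.set22 a b; rewrite -euv finset.in_set2 orbb => /eqP->.
    by left; rewrite eqxx.
  by left; rewrite !eqxx.
- have := finset.set22 b v; rewrite euv finset.in_set2 => /orP[]/eqP ev; subst v.
    by right; rewrite !eqxx.
  have := finset.set21 a b; rewrite -euv finset.in_set2 orbb => /eqP->.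
  by left; rewrite eqxx.
Qed.

Lemma adj_setD1 (V : finType) (E : {set {set V}}) (a b u v : V) :
  adj (E :\ [set a; b]%SET) u v =
  adj E u v && ([set u; v] != [set a; b])%SET.
Proof. by rewrite /adj finset.in_setD1 -andbA (andbC (_ != [set a; b]%SET)). Qed.

Lemma connected_setD1 (V : finType) (E : {set {set V}}) (a b : V) :
  connected_graph E -> connect (adj (E :\ [set a; b]%SET)) a b ->
  connected_graph (E :\ [set a; b]%SET).
Proof.
move=> cE cab u v; apply: connect_sub (cE u v) => {}u {}v uv.
have [|ne] := boolP ([set u; v] == [set a; b])%SET.
  rewrite set2_eq => /orP[]/andP[/eqP-> /eqP->] //.
  by rewrite connect_adj_sym.
by apply: connect1; rewrite adj_setD1 uv.
Qed.

(** The new edge repairs the deletion of [a b]: from [a] back to [u], across [u v], then from [v]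
    back to [b]. *)
Lemma connected_swap (V : finType) (E : {set {set V}}) (a b u v : V) :
  connected_graph E -> u != v ->
  connect (adj (E :\ [set a; b]%SET)) u a ->
  connect (adj (E :\ [set a; b]%SET)) b v ->
  connected_graph ([set u; v]%SET |: (E :\ [set a; b]%SET)).
Proof.
move=> cE uv ua bv; set F := _ |: _.
have sub : subrel (connect (adj (E :\ [set a; b]%SET))) (connect (adj F)).
  apply: connect_sub => s t st; apply: connect1.
  by move: st; rewrite /adj finset.in_setU1 => /andP[-> ->]; rewrite orbT.
have cab : connect (adj F) a b.
  rewrite connect_adj_sym; apply: connect_trans (sub _ _ bv) _.
  rewrite connect_adj_sym in ua; rewrite connect_adj_sym.
  apply: connect_trans (sub _ _ ua) _; apply: connect1.
  by rewrite /adj uv finset.setU11.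
move=> s t; apply: connect_sub (cE s t) => {}s {}t st.
have [|ne] := boolP ([set s; t] == [set a; b])%SET.
  rewrite set2_eq => /orP[]/andP[/eqP-> /eqP->] //.
  by rewrite connect_adj_sym.
by apply/sub/connect1; rewrite adj_setD1 st.
Qed.

(** Induction along a walk from [a]: each passage over the deleted edge merely changes which of its
    endpoints reaches the current vertex. *)
Lemma connect_setD1_cover (V : finType) (E : {set {set V}}) (a b w : V) :
  connected_graph E ->
  connect (adj (E :\ [set a; b]%SET)) a w \/
  connect (adj (E :\ [set a; b]%SET)) b w.
Proof.
move=> cE; have /connectP[p] := cE a w.
elim/last_ind: p w => [w _ ->|p c IH w]; first by left.
rewrite rcons_path last_rcons => /andP[pa cw] ew; subst c.
have [|ne] := boolP ([set last a p; w] == [set a; b])%SET.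
  by rewrite set2_eq => /orP[]/andP[_ /eqP->]; [right|left].
have lw : connect (adj (E :\ [set a; b]%SET)) (last a p) w.
  by apply: connect1; rewrite adj_setD1 cw.
by have [] := IH _ pa erefl => h; [left|right]; apply: connect_trans h lw.
Qed.

Lemma connect_exit (V : finType) (e : rel V) (S : {set V}) (u v : V) :
  connect e u v -> u \in S -> v \notin S ->
  exists a b, [/\ e a b, a \in S & b \notin S].
Proof.
move=> /connectP[p]; elim: p u => [|c p IH] u /=; first by move=> _ -> ->.
move=> /andP[uc pc] ev uS vS; have [cS|cS] := boolP (c \in S).
  exact: IH c pc ev cS vS.
by exists u, c.
Qed.

(* On a simple path the step leaving [S] is used only once, so both halves
   survive its deletion. *)
Lemma connect_exit_bridge (V : finType) (E : {set {set V}}) (S : {set V})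
    (u v : V) :
  connect (adj E) u v -> u \in S -> v \notin S ->
  exists a b, [/\ adj E a b, a \in S, b \notin S,
    connect (adj (E :\ [set a; b]%SET)) u a &
    connect (adj (E :\ [set a; b]%SET)) b v].
Proof.
move=> /connectP[p0 p0P ->]; case/shortenP: p0P => p pP pU _ {p0}.
elim: p u pP pU => [|c p IH] u /=; first by move=> _ _ ->.
move=> /andP[uc pc] /andP[uN pU] uS vS; have [cS|cS] := boolP (c \in S).
  have [a [b [ab aS bS ca bv]]] := IH c pc pU cS vS.
  exists a, b; split=> //; have [ua|ua] := eqVneq u a; first by rewrite ua.
  apply: connect_trans ca; apply: connect1; rewrite adj_setD1 uc /= set2_eq.
  rewrite (negbTE ua) /=; apply: contra bS => /andP[/eqP<- _] //.
exists u, c; split=> //; apply/connectP; exists p => //.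
apply: sub_in_path (allss (c :: p)) pc => s t sp tp st.
rewrite adj_setD1 st /= set2_eq negb_or !negb_and.
by rewrite (memPn uN s sp) (memPn uN t tp) !orbT.
Qed.

(** The rest of the cycle bypasses its first edge; with at least three distinct vertices it does not
    use that edge again. *)
Lemma ucycle_not_bridge (V : finType) (E : {set {set V}}) (c : seq V) :
  (2 < size c)%N -> ucycle (adj E) c ->
  exists a b, adj E a b /\ connect (adj (E :\ [set a; b]%SET)) a b.
Proof.
case: c => [|a [|b r]] //= sr /andP[/= /andP[ab pb] /and3P[aN bN rU]].
exists a, b; split=> //; rewrite connect_adj_sym.
case: r sr pb aN bN rU => [|b' r] // _ pb aN bN rU.
move: pb; rewrite rcons_path => /andP[pb la].
have pb' : path (adj (E :\ [set a; b]%SET)) b (b' :: r).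
  apply: sub_in_path (allss (b :: b' :: r)) pb => s t sp tp st.
  rewrite adj_setD1 st /= set2_eq negb_or !negb_and.
  by rewrite (memPn aN s sp) (memPn aN t tp) !orbT.
apply: (@connect_trans _ _ (last b (b' :: r))).
  by apply/connectP; exists (b' :: r).
apply: connect1; rewrite adj_setD1 la /= set2_eq negb_or !negb_and.
have lN : last b' r \in b' :: r by exact: mem_last.
by rewrite (memPn bN _ lN) (memPn aN _ (mem_last b (b' :: r))).
Qed.

Section Length.
Variables (R : realType) (d n : nat) (x : 'I_n -> d.-tuple R).
Implicit Types E F : {set {set 'I_n}}.

Lemma edist_sym (p q : d.-tuple R) : edist p q = edist q p.
Proof.
by rewrite /edist; congr Num.sqrt; apply: eq_bigr => j _; rewrite -opprB sqrrN.
Qed.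

Lemma edist_ge0 (p q : d.-tuple R) : 0 <= edist p q.
Proof. exact: sqrtr_ge0. Qed.

Lemma total_length_setD1 E (a b : 'I_n) : adj E a b ->
  total_length x E =
  edist (x a) (x b) + total_length x (E :\ [set a; b]%SET).
Proof.
wlog ab : a b / (a < b)%N => [hw|] adjab.
  have [ab|ba|/val_inj ab] := ltngtP a b; first exact: hw.
    by rewrite edist_sym finset.setUC; apply: hw; rewrite // adj_sym.
  by move: adjab; rewrite /adj ab eqxx.
rewrite /total_length !pair_big_dep (bigD1 (a, b)) /=; last by rewrite ab.
congr (_ + _); apply: eq_bigl => -[s t] /=; rewrite adj_setD1 set2_eq xpair_eqE.
rewrite -andbA; case st: (s < t)%N => //=; congr (_ && ~~ _).
case: (eqVneq s b) => [sb|_] /=; last by rewrite orbF.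
case: (eqVneq t a) => [ta|_]; last by rewrite orbF.
by move: st; rewrite sb ta ltnNge ltnW.
Qed.

Lemma total_length_setU1 E (a b : 'I_n) : a != b ->
  total_length x ([set a; b]%SET |: E) <=
  edist (x a) (x b) + total_length x E.
Proof.
move=> ab; have [abE|abE] := boolP ([set a; b]%SET \in E).
  by rewrite (finset.setUidPr _) ?finset.sub1set // lerDr edist_ge0.
rewrite (@total_length_setD1 _ a b); last by rewrite /adj ab finset.setU11.
by rewrite finset.setU1K.
Qed.

(** Edges lying on cycles are deleted one by one; lengths are nonnegative, so the total does not
    grow. Minimality can then be tested against any connected graph, and exchanges need not be shown
    to produce trees. *)
Lemma spanning_subtree E :
  (forall e, e \in E -> #|e| = 2%N) -> connected_graph E ->
  exists2 F, spanning_tree F & total_length x F <= total_length x E.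
Proof.
have [m] := ubnP #|E|; elim: m E => // m IH E; rewrite ltnS => Em E2 cE.
have [acE|] := pselect (acyclic_graph E); first by exists E.
move=> /existsNP[c] /not_implyP[sc] /contrapT uc.
have [a [b [ab cab]]] := ucycle_not_bridge sc uc.
have [||F treeF leF] := IH (E :\ [set a; b]%SET) _ _ (connected_setD1 cE cab).
- apply: leq_trans Em; have /andP[_ abE] := ab.
  by rewrite [X in (_ < X)%N](finset.cardsD1 [set a; b]%SET) abE.
- by move=> e; rewrite finset.in_setD1 => /andP[_]; exact: E2.
exists F => //; apply: le_trans leF _.
by rewrite (total_length_setD1 ab) lerDr edist_ge0.
Qed.

Lemma is_mst_connected E F : is_mst x E ->
  (forall e, e \in F -> #|e| = 2%N) -> connected_graph F ->
  total_length x E <= total_length x F.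
Proof.
move=> [_ minE] F2 cF; have [G treeG leG] := spanning_subtree F2 cF.
exact: le_trans (minE _ treeG) leG.
Qed.

(** The complete graph is connected, so spanning trees exist, and a finite set of them has a
    minimiser: [xget] never returns its default. *)
Lemma mstP : is_mst x (mst x).
Proof.
suff [E hE] : exists E, is_mst x E by exact: xgetPex (ex_intro _ E hE).
pose K : {set {set 'I_n}} := [set e : {set 'I_n} | #|e| == 2%N]%SET.
have K2 e : e \in K -> #|e| = 2%N by rewrite finset.inE => /eqP.
have cK : connected_graph K.
  move=> u v; have [->//|uv] := eqVneq u v.
  by apply: connect1; rewrite /adj uv finset.inE finset.cards2 uv.
have [F0 treeF0 _] := spanning_subtree K2 cK.
pose tree := fun F : {set {set 'I_n}} => `[< spanning_tree F >].
have tF0 : tree F0 by apply/asboolP.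
exists [arg min_(F < F0 | tree F) total_length x F]%O.
case: arg_minP => // F /asboolP treeF minF; split=> // G treeG.
by apply: minF; apply/asboolP.
Qed.

Lemma is_mst_swap E (a b u v : 'I_n) : is_mst x E -> adj E a b -> u != v ->
  connect (adj (E :\ [set a; b]%SET)) u a ->
  connect (adj (E :\ [set a; b]%SET)) b v ->
  edist (x a) (x b) <= edist (x u) (x v).
Proof.
move=> mstE ab uv ua bv; have [[E2 cE _] _] := mstE.
have := is_mst_connected mstE _ (connected_swap cE uv ua bv).
rewrite (total_length_setD1 ab) => h.
rewrite -(lerD2r (total_length x (E :\ [set a; b]%SET))).
apply: le_trans (h _) (total_length_setU1 _ uv) => e.
rewrite finset.in_setU1 finset.in_setD1 => /orP[/eqP->|/andP[_]]; last exact: E2.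
by rewrite finset.cards2 uv.
Qed.

(** Cycle property: deleting [u v] separates [u] from [v], a path of shorter edges crosses this
    separation somewhere, and the crossing edge could replace [u v] at a lower cost. *)
Lemma mst_no_shortcut E (u v : 'I_n) : is_mst x E -> adj E u v ->
  ~~ connect [rel a b | edist (x a) (x b) < edist (x u) (x v)] u v.
Proof.
move=> mstE uv; apply/negP => cuv; have [[E2 cE _] _] := mstE.
(* If the tree without [u v] still joins [u] to [v], minimality forces the length of [u v] to be at
   most 0, and no edge is shorter than that. *)
have [uvE|uvN] := boolP (connect (adj (E :\ [set u; v]%SET)) u v).
  have h := is_mst_connected mstE _ (connected_setD1 cE uvE).
  have {h} : total_length x E <= total_length x (E :\ [set u; v]%SET).
    by apply: h => e /finset.setD1P[_]; exact: E2.
  rewrite (total_length_setD1 uv) gerDr => uv0; move/connectP: cuv => [[|c p] /=].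
    by move=> _ evu; move: uv; rewrite /adj evu eqxx.
  by move=> /andP[uc _] _; move: (le_lt_trans (edist_ge0 _ _) uc); rewrite ltNge uv0.
pose S := [set w | connect (adj (E :\ [set u; v]%SET)) u w]%SET.
have uS : u \in S by rewrite finset.inE.
have vS : v \notin S by rewrite finset.inE.
have [a [b [/= ab]]] := connect_exit cuv uS vS.
rewrite !finset.inE => ua ub.
have vb : connect (adj (E :\ [set u; v]%SET)) v b.
  by have [h|//] := connect_setD1_cover u v b cE; rewrite h in ub.
have neab : a != b by apply: contraNneq ub => <-.
have := is_mst_swap mstE uv neab; rewrite connect_adj_sym => /(_ ua vb).
by rewrite leNgt ab.
Qed.

(** Cut property: the tree path from [u] to [v] leaves [S] through some edge, and if this were not
    [u v], exchanging it for [u v] would shorten the tree. *)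
Lemma mst_cut E (S : {set 'I_n}) (u v : 'I_n) : is_mst x E ->
  u \in S -> v \notin S ->
  (forall a b, a \in S -> b \notin S -> (a, b) != (u, v) ->
    edist (x u) (x v) < edist (x a) (x b)) ->
  adj E u v.
Proof.
move=> mstE uS vS minuv; have [[E2 cE _] _] := mstE.
have [a [b [ab aS bS ua bv]]] := connect_exit_bridge (cE u v) uS vS.
have [[<- <-]//|ne] := eqVneq (a, b) (u, v).
have uv : u != v by apply: contraNneq vS => <-.
by have := is_mst_swap mstE ab uv ua bv; rewrite leNgt minuv.
Qed.

End Length.

(** The neighbours of [v] are exactly [Y]. A point [y != y0] of [Y] is joined to [v] through the cut
    around [y] alone; [y0] through the cut around the star formed by [v] and the rest of [Y], which
    allows [y0] to have points nearer than [v]. All other points are excluded by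
    [mst_no_shortcut]. *)
Lemma mst_star_degree (R : realType) (d n : nat) (x : 'I_n -> d.-tuple R)
    (v y0 : 'I_n) (Y : {set 'I_n}) :
  v \notin Y -> y0 \in Y ->
  (forall y w, y \in Y -> y != y0 -> w != y -> w != v ->
    edist (x y) (x v) < edist (x y) (x w)) ->
  (forall a b, a \in (v |: (Y :\ y0))%SET -> b \notin (v |: (Y :\ y0))%SET ->
    (a, b) != (v, y0) -> edist (x v) (x y0) < edist (x a) (x b)) ->
  (forall w, w \notin Y -> w != v ->
    connect [rel a b | edist (x a) (x b) < edist (x v) (x w)] v w) ->
  degree (mst x) v = #|Y|.
Proof.
move=> vY y0Y near_v cut_v far_v; rewrite /degree; apply: eq_card => w.
have mstE := mstP x; rewrite !finset.inE; have [wY|wY] := boolP (w \in Y); last first.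
  apply/negP => vw; have wv : w != v by move: vw; rewrite /adj eq_sym => /andP[].
  by have := mst_no_shortcut mstE vw; rewrite far_v.
have [->{w wY}|wy0] := eqVneq w y0.
  apply: (mst_cut mstE (S := (v |: (Y :\ y0))%SET)) => //.
  - by rewrite !finset.inE eqxx.
  - by rewrite !finset.inE eqxx /= orbF; apply: contraNneq vY => <-.
have wv : w != v by apply: contraNneq vY => <-.
rewrite adj_sym; apply: (mst_cut mstE (S := [set w]%SET)) => //.
- by rewrite finset.inE.
- by rewrite finset.inE eq_sym.
move=> a b; rewrite !finset.inE xpair_eqE => /eqP -> bw; rewrite eqxx /= => bv.
exact: near_v.
Qed.

(** * Squared distances and walks away from the origin *)

Section SquaredDistance.
Variables (R : realType) (d : nat).
Implicit Types p q r : 'I_d -> R.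

Definition dot p q : R := \sum_j p j * q j.

Definition sqd p q : R := \sum_j (p j - q j) ^+ 2.

Lemma sqdE p q : sqd p q = dot p p - 2 * dot p q + dot q q.
Proof.
rewrite /sqd /dot mulr_sumr -sumrB -big_split /=.
by apply: eq_bigr => j _; ring.
Qed.

Lemma sqd_sym p q : sqd p q = sqd q p.
Proof. by apply: eq_bigr => j _; ring. Qed.

Lemma sqd0 p : sqd (fun=> 0) p = dot p p.
Proof. by apply: eq_bigr => j _; ring. Qed.

Lemma sqdxx p : sqd p p = 0.
Proof. by rewrite /sqd big1 // => j _; rewrite subrr expr0n. Qed.

Lemma sqd_ge0 p q : 0 <= sqd p q.
Proof. by apply: sumr_ge0 => j _; exact: sqr_ge0. Qed.

Lemma dot_ge0 p : 0 <= dot p p.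
Proof. by rewrite -sqd0 sqd_ge0. Qed.

Lemma sqr_le_sqd p q j : (p j - q j) ^+ 2 <= sqd p q.
Proof.
by rewrite /sqd (bigD1 j) //= lerDl sumr_ge0 // => i _; exact: sqr_ge0.
Qed.

Lemma dotC p q : dot p q = dot q p.
Proof. by apply: eq_bigr => j _; rewrite mulrC. Qed.

Lemma dotZ a p q : dot (fun j => a * p j) q = a * dot p q.
Proof. by rewrite /dot mulr_sumr; apply: eq_bigr => j _; rewrite mulrA. Qed.

Lemma dot_lincomb a p b q r :
  dot (fun j => a * p j + b * q j) r = a * dot p r + b * dot q r.
Proof.
by rewrite /dot !mulr_sumr -big_split /=; apply: eq_bigr => j _; ring.
Qed.

Lemma edist_sqd (p q : d.-tuple R) : edist p q = Num.sqrt (sqd (tnth p) (tnth q)).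
Proof. by []. Qed.

Lemma edist_lt (p q p' q' : d.-tuple R) :
  (edist p q < edist p' q') =
  (sqd (tnth p) (tnth q) < sqd (tnth p') (tnth q')).
Proof.
rewrite !edist_sqd; apply/idP/idP => [|h]; last first.
  by rewrite ltr_sqrt // (le_lt_trans (sqd_ge0 _ _) h).
by apply: contraTT; rewrite -!leNgt => h; exact: ler_wsqrtr.
Qed.

Lemma sqd_scale (z : 'I_d -> R) (s : R) p q :
  sqd (fun j => z j + s * p j) (fun j => z j + s * q j) = s ^+ 2 * sqd p q.
Proof. by rewrite /sqd mulr_sumr; apply: eq_bigr => j _; ring. Qed.

Definition ax (a : R) (i : 'I_d) : 'I_d -> R := fun l => a * (l == i)%:R.

Lemma dot_ax a i q : dot (ax a i) q = a * q i.
Proof.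
rewrite /dot (bigD1 i) //= big1 ?addr0 /ax ?eqxx ?mulr1 // => l li.
by rewrite (negbTE li) mulr0 mul0r.
Qed.

Lemma dot_axD a i b j q :
  dot (fun l => ax a i l + ax b j l) q = a * q i + b * q j.
Proof.
rewrite -!dot_ax /dot -big_split /=.
by apply: eq_bigr => l _; rewrite mulrDl.
Qed.

(** The first condition makes the step shorter than the distance from the origin to its end; the
    second makes these distances increase. Hence all edges of a chain of such steps are shorter than
    the distance from the origin to the end of the chain. *)
Definition outward p q :=
  (sqd p q < sqd (fun=> 0) q) && (sqd (fun=> 0) p < sqd (fun=> 0) q).

Lemma outwardE p q :
  outward p q = (dot p p < 2 * dot p q) && (dot p p < dot q q).
Proof.
rewrite /outward !sqd0 sqdE; congr (_ && _).
by rewrite -subr_gt0 -[RHS]subr_gt0; congr (_ < _); ring.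
Qed.

(** The squared norms of the three points are [a^2], [2 a^2], [4 a^2], and the squared lengths of
    the two steps are [a^2] and [2 a^2]. *)
Lemma outward_turn a b i j : i != j -> a != 0 -> b ^+ 2 = a ^+ 2 ->
  outward (ax a i) (fun l => ax a i l + ax b j l) &&
  outward (fun l => ax a i l + ax b j l) (ax (2 * b) j).
Proof.
move=> ij a0 ab; have a20 : 0 < a ^+ 2 by rewrite exprn_even_gt0.
rewrite !outwardE !(dot_axD, dot_ax) /ax !eqxx (negbTE ij).
rewrite (negbTE (contraNneq _ ij : j != i)); last by move->.
rewrite /= in ab a20 *; by apply/andP; split; apply/andP; split; nra.
Qed.

(** The half-axes in [ds] are visited one after the other, each turn doubling the distance to the
    origin. *)
Lemma outward_walk (ds : seq ('I_d * bool)) (a : R) (i : 'I_d) :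
  (1 < d)%N -> 3 <= `|a| ->
  exists zs, [/\ path outward (ax a i) zs,
    forall z, z \in ax a i :: zs -> 9 <= sqd (fun=> 0) z &
    forall j s, (j, s) \in ds ->
      exists2 B, 3 <= B & ax ((-1) ^+ s * B) j \in ax a i :: zs].
Proof.
move=> d1; have N9 b l : 3 <= `|b| -> 9 <= sqd (fun=> 0) (ax b l).
  move=> b3; rewrite sqd0 dot_ax /ax eqxx mulr1 -expr2 -real_normK ?num_real //.
  by nra.
elim: ds a i => [|[j s] ds IH] a i a3.
  by exists [::]; split=> // z; rewrite inE => /eqP ->; exact: N9.
have a0 : a != 0 by rewrite -normr_gt0; lra.
(* A turn has to change the axis. If the target lies on the current axis, the walk first turns onto
   another axis [l], which exists since [1 < d]. *)
wlog ij : a i a3 a0 / i != j => [hw|].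
  have [ij|] := eqVneq i j; last exact: hw.
  pose l : 'I_d := if val i == 0 then Ordinal d1 else Ordinal (ltnW d1).
  have il : i != l.
    apply/eqP => /(congr1 val); rewrite /l; case: (eqVneq (val i) 0) => /= [->//|].
    by move=> i0 i0'; rewrite i0' in i0.
  have /andP[st1 st2] := outward_turn il a0 (erefl (a ^+ 2)).
  have b3 : 3 <= `|2 * a| by rewrite normrM (ger0_norm (ler0n _ 2)); lra.
  have b0 : 2 * a != 0 by rewrite mulf_neq0 // pnatr_eq0.
  have lj : l != j by rewrite -ij eq_sym.
  have [zs [pz zs9 zsd]] := hw _ _ b3 b0 lj.
  exists ((fun k => ax a i k + ax a l k) :: ax (2 * a) l :: zs); split.
  - by rewrite /= st1 st2.
  - move=> z; rewrite !inE => /or3P[/eqP->|/eqP->|zz]; first exact: N9.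
      move: st1 => /andP[_ /ltW]; apply: le_trans; exact: N9.
    by apply: zs9.
  - move=> j' s' js'; have [B B3 hB] := zsd _ _ js'.
    by exists B => //; rewrite !inE in hB *; rewrite hB !orbT.
pose b := (-1) ^+ s * `|a|.
have ba : b ^+ 2 = a ^+ 2.
  by rewrite /b exprMn -exprM mulnC exprM sqrrN expr1n expr1n mul1r real_normK ?num_real.
have /andP[st1 st2] := outward_turn ij a0 ba.
have b3 : 3 <= `|2 * b|.
  by rewrite /b !normrM normrX normrN1 expr1n mul1r normr_id (ger0_norm (ler0n _ 2)); lra.
have [zs [pz zs9 zsd]] := IH _ j b3.
exists ((fun k => ax a i k + ax b j k) :: ax (2 * b) j :: zs); split.
- by rewrite /= st1 st2.
- move=> z; rewrite !inE => /or3P[/eqP->|/eqP->|zz]; first exact: N9.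
    move: st1 => /andP[_ /ltW]; apply: le_trans; exact: N9.
  by apply: zs9.
- move=> j' s'; rewrite inE => /orP[/eqP[-> ->]|js'].
    exists (2 * `|a|); first lra.
    by rewrite mulrCA -/b !inE eqxx !orbT.
  have [B B3 hB] := zsd _ _ js'.
  by exists B => //; rewrite !inE in hB *; rewrite hB !orbT.
Qed.

(** The walk goes from [u] to [3 u] and then onto an axis [i] with [u i != 0]. The point [4 / u i]
    on that axis has inner product 12 with [3 u] and norm at least 4, so that step is outward. *)
Lemma outward_walk_from_unit (u : 'I_d -> R) : (1 < d)%N -> dot u u = 1 ->
  exists zs, [/\ path outward u zs,
    forall z, z \in zs -> 9 <= sqd (fun=> 0) z &
    forall j (s : bool), exists2 B, 3 <= B & ax ((-1) ^+ s * B) j \in zs].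
Proof.
move=> d1 u1.
have [i ui] : exists i, u i != 0.
  apply/not_existsP => u0; move: u1; rewrite /dot big1 => [/esym/eqP|j _].
    by rewrite oner_eq0.
  by have /negP := u0 j; rewrite negbK => /eqP->; rewrite mulr0.
have ui1 : `|u i| <= 1.
  rewrite -ler_sqr ?nnegrE // expr1n real_normK ?num_real //.
  by rewrite -[leRHS]u1 -sqd0 sqd_sym -[u i]subr0 sqr_le_sqd.
have u0 : 0 < `|u i| by rewrite normr_gt0.
have a4 : 4 <= `|4 / u i|.
  rewrite normrM normfV (ger0_norm (ler0n _ 4)) ler_pdivlMr //; lra.
have [|zs [pz zs9 zsd]] := @outward_walk (enum {: 'I_d * bool}) (4 / u i) i d1.
  by lra.
pose t : 'I_d -> R := fun j => 3 * u j.
exists (t :: ax (4 / u i) i :: zs); split.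
- have tt : dot t t = 9 by rewrite dotZ dotC dotZ u1; lra.
  have ut : dot u t = 3 by rewrite dotC dotZ u1; lra.
  have ta : dot t (ax (4 / u i) i) = 12.
    by rewrite dotZ dotC dot_ax divfK //; lra.
  have aa : 16 <= dot (ax (4 / u i) i) (ax (4 / u i) i).
    rewrite dot_ax /ax eqxx mulr1 -expr2 -real_normK ?num_real //; nra.
  rewrite /= pz andbT !outwardE tt ut ta u1.
  by apply/andP; split; apply/andP; split; lra.
- move=> z; rewrite inE => /orP[/eqP->|]; last exact: zs9.
  by rewrite sqd0 dotZ dotC dotZ u1; lra.
- move=> j s; have [|B B3 hB] := zsd j s; first by rewrite mem_enum.
  by exists B => //; rewrite inE hB orbT.
Qed.

End SquaredDistance.

(** * Directions of a strict kissing configuration *)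

Section Kissing.
Variables (R : realType) (d : nat).
Implicit Types o c p q : d.-tuple R.

Lemma esphereP c (r : R) p : 0 <= r ->
  esphere c r p <-> sqd (tnth c) (tnth p) = r ^+ 2.
Proof.
move=> r0; rewrite /esphere /= edist_sqd; split=> [<-|->].
  by rewrite sqr_sqrtr ?sqd_ge0.
by rewrite sqrtr_sqr ger0_norm.
Qed.

(* The reflection of the tangency point in the line of centres lies on both
   spheres, so the tangency point is on that line. *)
Lemma tangent_sqd o c (e : R) : 0 < e ->
  tangent (esphere o 1) (esphere c (1 + e)) ->
  sqd (tnth o) (tnth c) = e ^+ 2 \/ sqd (tnth o) (tnth c) = (2 + e) ^+ 2.
Proof.
move=> e0 [p Sp]; have e1 : 0 <= 1 + e by lra.
have [op cp] : esphere o 1 p /\ esphere c (1 + e) p.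
  by have : [set p] p by []; rewrite -Sp.
move/(esphereP _ _ ler01) : op => op; move/(esphereP _ _ e1) : cp => cp.
pose a j := tnth p j - tnth o j; pose b j := tnth c j - tnth o j.
have aE : dot a a = 1.
  by rewrite -sqd0 -(expr1n _ 2) -op; apply: eq_bigr => j _; rewrite /a; ring.
have bE : sqd (tnth o) (tnth c) = dot b b.
  by rewrite -sqd0; apply: eq_bigr => j _; rewrite /b; ring.
have abE : sqd b a = (1 + e) ^+ 2.
  by rewrite -cp; apply: eq_bigr => j _; rewrite /a /b; ring.
rewrite bE; set B := dot b b; set g := dot a b.
have abE' : 1 - 2 * g + B = (1 + e) ^+ 2.
  by rewrite -abE sqd_sym sqdE aE.
have B0 : B != 0.
  apply/eqP => B0; have b0 j : b j = 0.
    apply/eqP; rewrite -sqrf_eq0 eq_le sqr_ge0 andbT -B0 /B -sqd0 sqd_sym.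
    by rewrite -{1}[b j]subr0 sqr_le_sqd.
  have : g = 0 by rewrite /g /dot big1 // => j _; rewrite b0 mulr0.
  by move: abE'; rewrite B0; nra.
pose l := g / B.
pose a' j := 2 * l * b j + (- 1) * a j.
pose p' := [tuple tnth o j + a' j | j < d].
have aa' : dot a' a' = 1.
  rewrite dot_lincomb (dotC b) (dotC a) !dot_lincomb aE -/B (dotC b) -/g /l.
  by field.
have ba' : dot a' b = g.
  by rewrite dot_lincomb -/B -/g /l; field.
have : [set p] p'.
  rewrite -Sp; split.
    apply/(esphereP _ _ ler01); rewrite expr1n -aa' -sqd0.
    by apply: eq_bigr => j _; rewrite tnth_mktuple; ring.
  apply/(esphereP _ _ e1); transitivity (sqd a' b).
    by apply: eq_bigr => j _; rewrite tnth_mktuple /b; ring.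
  by rewrite sqdE aa' ba' -/B.
move=> /= p'p; have al j : a j = l * b j.
  have : tnth p' j = tnth p j by rewrite p'p.
  rewrite tnth_mktuple /a' /a; lra.
have gE : g = l * B.
  by rewrite /l divfK.
have lB : l ^+ 2 * B = 1.
  rewrite -aE (_ : a = fun j => l * b j); last exact/funext.
  by rewrite dotZ dotC dotZ -/B; ring.
(* With [a = l b], the two radii give a quadratic equation for [l]. Its root [1 / (2 + e)] is
   external tangency, and its root [- 1 / e] is internal tangency. *)
have : (1 - (2 + e) * l) * (1 + e * l) = 0.
  have : (l - 1) ^+ 2 * B = (1 + e) ^+ 2 by rewrite -abE' gE; lra.
  move=> h; suff /(mulIf B0) : (l - 1) ^+ 2 * B = (1 + e) ^+ 2 * l ^+ 2 * B by lra.
  by rewrite h -mulrA lB mulr1.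
move=> /eqP; rewrite mulf_eq0 => /orP[]/eqP lE; [right|left].
  have -> : B = ((2 + e) * l) ^+ 2 * B by rewrite (_ : (2 + e) * l = 1) ?expr1n ?mul1r //; lra.
  by rewrite exprMn -mulrA lB mulr1.
have -> : B = (e * l) ^+ 2 * B by rewrite (_ : e * l = -1) ?sqrrN ?expr1n ?mul1r //; lra.
by rewrite exprMn -mulrA lB mulr1.
Qed.

Lemma exists_orthogonal (b : 'I_d -> R) : (1 < d)%N ->
  exists w, dot w b = 0 /\ 0 < dot w w.
Proof.
move=> d1; pose i : 'I_d := Ordinal (ltnW d1); pose j : 'I_d := Ordinal d1.
have ij : (i == j) = false by [].
have [/andP[/eqP bi /eqP bj]|b0] := boolP ((b i == 0) && (b j == 0)).
  exists (ax 1 i); rewrite !dot_ax bi /ax eqxx mulr1 mulr1; split=> //; lra.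
exists (fun l => ax (b j) i l + ax (- b i) j l).
rewrite !dot_axD; split; first by ring.
rewrite /ax !eqxx ij eq_sym ij /= !mulr0 addr0 add0r !mulr1 mulrNN -!expr2.
rewrite lt_neqAle addr_ge0 ?sqr_ge0 // andbT eq_sym paddr_eq0 ?sqr_ge0 //.
by rewrite !sqrf_eq0 andbC.
Qed.

(** If the centres were at distance at most [2 r], the spheres would meet at the midpoint of the
    centres shifted along an orthogonal direction, by the amount given by Pythagoras. The orthogonal
    direction is where [1 < d] enters. *)
Lemma disjoint_spheres_sqd c c' (r : R) : (1 < d)%N -> 0 <= r ->
  esphere c r `&` esphere c' r = set0 ->
  4 * r ^+ 2 < sqd (tnth c) (tnth c').
Proof.
move=> d1 r0 S0; rewrite ltNge; apply/negP => le4.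
pose b j := tnth c' j - tnth c j.
have bE : sqd (tnth c) (tnth c') = dot b b.
  by rewrite -sqd0; apply: eq_bigr => j _; rewrite /b; ring.
have [w [wb w0]] := exists_orthogonal b d1.
pose l := Num.sqrt ((r ^+ 2 - dot b b / 4) / dot w w).
have lE : l ^+ 2 * dot w w = r ^+ 2 - dot b b / 4.
  have h : 0 <= r ^+ 2 - dot b b / 4 by rewrite -bE; move: le4; clear; lra.
  by rewrite sqr_sqrtr ?divfK ?gt_eqF // divr_ge0 // ltW.
have H (s : R) : s ^+ 2 = 1 / 4 ->
    dot (fun j => s * b j + l * w j) (fun j => s * b j + l * w j) = r ^+ 2.
  move=> s4; rewrite dot_lincomb (dotC b) (dotC w) !dot_lincomb (dotC b w) wb.
  rewrite mulr0 addr0 mulr0 add0r !mulrA -!expr2 s4 lE; lra.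
pose p := [tuple tnth c j + (1 / 2 * b j + l * w j) | j < d].
suff : (esphere c r `&` esphere c' r) p by rewrite S0.
split; apply/(esphereP _ _ r0).
  rewrite -(H (1 / 2)) -?sqd0; last by field.
  by apply: eq_bigr => j _; rewrite tnth_mktuple; ring.
rewrite -(H (- (1 / 2))) -?sqd0; last by field.
by apply: eq_bigr => j _; rewrite tnth_mktuple /b; field.
Qed.

(** The directions from the common centre to the centres of the spheres: these are at distance
    [2 + e] from it and more than [2 (1 + e)] apart, so after division by [2 + e] they are more than
    1 apart. *)
Lemma strict_kissing_directions (k : nat) : (1 < d)%N ->
  (k <= strict_kissing_number R d)%N ->
  exists u : 'I_k -> 'I_d -> R, (forall i, dot (u i) (u i) = 1) /\
    forall i j, i != j -> 1 < sqd (u i) (u j).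
Proof.
(* A single sphere could be internally tangent, so [k <= 1] is served by an explicit vector. For
   larger [k] the default value 0 of the kissing number contradicts [k <= 0]. *)
move=> d1; have [k1 _|k1] := leqP k 1.
  exists (fun=> ax 1 (Ordinal d1)); split=> [i|i j /eqP[]].
    by rewrite dot_ax /ax eqxx !mulr1.
  apply/val_inj; have := leq_trans (ltn_ord i) k1; have := leq_trans (ltn_ord j) k1.
  by rewrite !ltnS !leqn0 => /eqP j0 /eqP i0; exact: etrans i0 (esym j0).
rewrite /strict_kissing_number; case: xgetP => [K _ [conf _] kK|_]; last first.
  by rewrite leqNgt (ltn_trans _ k1).
have [e [q [c [e0 ctan cdisj]]]] := conf.
pose b i j := tnth (c i) j - tnth q j.
have far i j : i != j -> 4 * (1 + e) ^+ 2 < sqd (b i) (b j).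
  move=> /cdisj /(disjoint_spheres_sqd d1) h; apply: lt_le_trans (h _) _; first lra.
  by rewrite le_eqVlt; apply/orP; left; apply/eqP; apply: eq_bigr => l _; rewrite /b; ring.
have bE i : dot (b i) (b i) = e ^+ 2 \/ dot (b i) (b i) = (2 + e) ^+ 2.
  have -> : dot (b i) (b i) = sqd (tnth q) (tnth (c i)).
    by rewrite -sqd0; apply: eq_bigr => l _; rewrite /b; ring.
  exact: tangent_sqd.
(* An internally tangent sphere would be too close to any other one. *)
have ext i : dot (b i) (b i) = (2 + e) ^+ 2.
  have [bi|//] := bE i.
  have [j ij] : exists j, i != j.
    have K1 : (1 < K)%N by exact: leq_trans kK.
    have [->|i0] := eqVneq i (Ordinal (ltnW K1)); first by exists (Ordinal K1).
    by exists (Ordinal (ltnW K1)).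
  have := far i j ij; rewrite sqdE bi.
  have [bj|bj] := bE j.
    have := dot_ge0 (fun l => 1 * b i l + 1 * b j l).
    rewrite dot_lincomb (dotC (b i)) (dotC (b j)) !dot_lincomb (dotC (b j) (b i)) bi bj; nra.
  (* Cauchy-Schwarz for vectors of norms [e] and [2 + e]: the two centres would be at distance at
     most [2 (1 + e)]. *)
  have := dot_ge0 (fun l => (2 + e) * b i l + e * b j l).
  rewrite dot_lincomb (dotC (b i)) (dotC (b j)) !dot_lincomb (dotC (b j) (b i)) bi bj.
  set g := dot _ _ => h.
  have : 0 <= e * (2 + e) * (2 * e * (2 + e) + 2 * g) by apply: le_trans h _; lra.
  rewrite pmulr_rge0; last by rewrite mulr_gt0 //; lra.
  nra.
have e2 : 2 + e != 0 by rewrite gt_eqF //; lra.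
exists (fun i l => (2 + e)^-1 * b (widen_ord kK i) l); split=> [i|i j ij].
  by rewrite dotZ dotC dotZ ext; field.
have /far : widen_ord kK i != widen_ord kK j.
  by apply: contra ij => /eqP/(congr1 val) /= /val_inj /eqP.
set bi := b _; set bj := b _ => h.
have -> : sqd (fun l => (2 + e)^-1 * bi l) (fun l => (2 + e)^-1 * bj l) =
    (2 + e)^-1 ^+ 2 * sqd bi bj.
  by rewrite /sqd mulr_sumr; apply: eq_bigr => l _; ring.
rewrite exprVn mulrC ltr_pdivlMr ?mul1r ?exprn_gt0 //; first nra.
by lra.
Qed.

End Kissing.

(** * The pattern *)

Lemma finite_positive_lower_bound (R : realType) (T : finType) (F : T -> R) :
  exists2 g, 0 < g <= 1 & forall t, 0 < F t -> g <= F t.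
Proof.
suff [g g01 gF] : exists2 g, 0 < g <= 1 & forall t, t \in enum T -> 0 < F t -> g <= F t.
  by exists g => // t; apply: gF; rewrite mem_enum.
elim: (enum T) => [|t s [g /andP[g0 g1] gF]]; first by exists 1 => //; lra.
have [Ft|Ft] := ltP 0 (F t); last first.
  exists g; first by rewrite g0.
  by move=> t'; rewrite inE => /orP[/eqP->|/gF//]; rewrite ltNge Ft.
exists (Num.min g (F t)); first by rewrite lt_min g0 Ft /= ge_min g1.
move=> t'; rewrite inE ge_min => /orP[/eqP->|/gF h /h ->//].
by rewrite lexx orbT.
Qed.

Lemma finite_upper_bound (R : realType) (T : finType) (F : T -> R) :
  exists2 K, 3 <= K & forall t, F t <= K.
Proof.
exists (3 + \sum_t `|F t|) => [|t]; first by rewrite lerDl sumr_ge0.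
rewrite (bigD1 t) //= addrCA; apply: le_trans (ler_norm _) _.
by rewrite lerDl addr_ge0 // sumr_ge0.
Qed.

Section Perturbation.
Variables (R : realType) (d : nat).
Implicit Types p q r w : 'I_d -> R.

Lemma ler_sum_const (F : 'I_d -> R) (c : R) :
  (forall j, F j <= c) -> \sum_j F j <= d%:R * c.
Proof.
move=> Fc; apply: le_trans (ler_sum _ (fun j _ => Fc j)) _.
by rewrite sumr_const card_ord mulr_natl.
Qed.

Lemma sqd_perturb (K eta : R) p q p' q' : 0 <= eta <= 1 ->
  (forall j, `|p j| <= K) -> (forall j, `|q j| <= K) ->
  (forall j, `|p' j - p j| <= eta) -> (forall j, `|q' j - q j| <= eta) ->
  sqd p' q' <= sqd p q + d%:R * ((8 * K + 4) * eta) /\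
  sqd p q <= sqd p' q' + d%:R * ((8 * K + 4) * eta).
Proof.
move=> /andP[eta0 eta1] pK qK pp' qq'.
have H j : `|(p' j - q' j) ^+ 2 - (p j - q j) ^+ 2| <= (8 * K + 4) * eta.
  have := pK j; have := qK j; have := pp' j; have := qq' j.
  rewrite !ler_norml => /andP[q1 q2] /andP[p1 p2] /andP[q3 q4] /andP[p3 p4].
  set t := p j - q j; set s := (p' j - p j) - (q' j - q j).
  have -> : (p' j - q' j) ^+ 2 - t ^+ 2 = s * (2 * t + s) by rewrite /t /s; ring.
  have s2 : `|s| <= 2 * eta by rewrite ler_norml /s; lra.
  have t2 : `|2 * t + s| <= 4 * K + 2 by rewrite ler_norml /t /s; lra.
  have : `|s| * `|2 * t + s| <= (2 * eta) * (4 * K + 2) by exact: ler_pM.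
  by rewrite -normrM ler_norml; lra.
split; rewrite -lerBlDl /sqd -sumrB; apply: ler_sum_const => j.
  by have := H j; rewrite ler_norml; lra.
by have := H j; rewrite ler_norml; lra.
Qed.

(** Finitely many strict inequalities have a least gap [g]. The tolerance [eta = g / D] changes each
    squared distance by at most [g / 3], so two such changes cannot close a gap. *)
Lemma sqd_order_stable (I : finType) (p : I -> 'I_d -> R) (K : R) :
  (0 < d)%N -> 3 <= K -> (forall a j, `|p a j| <= K) ->
  exists2 eta, 0 < eta & d%:R * eta <= 1 / 4 /\
    forall p' : I -> 'I_d -> R, (forall a j, `|p' a j - p a j| <= eta) ->
    forall a b a' b', sqd (p a) (p b) < sqd (p a') (p b') ->
      sqd (p' a) (p' b) < sqd (p' a') (p' b').
Proof.
move=> d0 K3 pK.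
pose gap (t : (I * I) * (I * I)) :=
  sqd (p t.2.1) (p t.2.2) - sqd (p t.1.1) (p t.1.2).
have [g /andP[g0 g1] gapg] := finite_positive_lower_bound gap.
have d1 : 1 <= d%:R :> R by rewrite ler1n.
pose D := 3 * d%:R * (8 * K + 4).
have D0 : 0 < D by rewrite /D mulr_gt0 ?mulr_gt0 //; lra.
have dD : 4 * d%:R <= D by rewrite /D; nra.
have etaE : g / D * D = g by rewrite divfK ?gt_eqF.
have eta0 : 0 < g / D by rewrite divr_gt0.
set eta := g / D in etaE eta0 *.
exists eta => //; split; first by nra.
move=> p' pp' a b a' b' lt_ab.
have eta1 : 0 <= eta <= 1 by rewrite ltW //=; nra.
have [h _] := sqd_perturb eta1 (pK a) (pK b) (pp' a) (pp' b).
have [_ h'] := sqd_perturb eta1 (pK a') (pK b') (pp' a') (pp' b').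
have := gapg ((a, b), (a', b')); rewrite /gap /= subr_gt0 => /(_ lt_ab).
have : 3 * (d%:R * ((8 * K + 4) * eta)) = g by rewrite -etaE /D; ring.
move: h h'; set X := d%:R * _; lra.
Qed.

(* [z'] is a perturbed shield point on the half-axis of sign [s] in direction
   [j], and [v'] the perturbed centre. *)
Lemma closer_to_axis_point (eta B K : R) (j : 'I_d) (s : bool) w v' z' :
  0 < eta -> d%:R * eta <= 1 / 4 -> 3 <= B -> B <= K -> K + 2 < `|w j| ->
  (forall i, `|w i| <= `|w j|) -> (-1) ^+ s * w j = `|w j| ->
  (forall i, `|v' i| <= eta) ->
  (forall i, `|z' i - ax ((-1) ^+ s * B) j i| <= eta) ->
  sqd z' w < sqd v' w.
Proof.
move=> eta0 deta B3 BK wK wmax sw v'0 z'z.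
set t := `|w j| in wK wmax sw *.
have d1 : 1 <= d%:R :> R by rewrite ler1n (leq_ltn_trans _ (ltn_ord j)).
have eta4 : eta <= 1 / 4 by nra.
rewrite -subr_lt0 /sqd -sumrB (bigD1 j) //=.
have wj : w j = (-1) ^+ s * t by rewrite -sw mulrA -expr2 sqrr_sign mul1r.
(* Since [B >= 3] and [t > B + 2], coordinate [j] gains more than [5 t / 2], whereas the other
   coordinates together lose at most [eta + t], because [d * eta <= 1 / 4]. *)
have Hj : (z' j - w j) ^+ 2 - (v' j - w j) ^+ 2 <= - (B - 1 / 2) * (2 * t - B - 1 / 2).
  have := z'z j; rewrite /ax eqxx mulr1 wj => zj; have vj := v'0 j.
  pose x := (-1) ^+ s * z' j - B; pose y := (-1) ^+ s * v' j.
  have ss : (-1) ^+ s * (-1) ^+ s = 1 :> R by rewrite -expr2 sqrr_sign.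
  have zE : z' j = (-1) ^+ s * (B + x) by rewrite /x addrC subrK mulrA ss mul1r.
  have vE : v' j = (-1) ^+ s * y by rewrite /y mulrA ss mul1r.
  move: zj; rewrite zE -mulrBr normrMsign.
  rewrite (addrC B) addrK ler_norml => /andP[x1 x2].
  move: vj; rewrite vE normrMsign ler_norml => /andP[y1 y2].
  rewrite -!mulrBr !exprMn !expr2 ss !mul1r; clear zE vE ss; nra.
have Hi : \sum_(i < d | i != j) ((z' i - w i) ^+ 2 - (v' i - w i) ^+ 2) <=
    d%:R * (2 * eta * (2 * eta + 2 * t)).
  have c0 : 0 <= 2 * eta * (2 * eta + 2 * t) by nra.
  apply: le_trans (ler_sum_const (fun=> lexx _)).
  rewrite [leRHS](bigD1 j) //=; apply: ler_wpDl => //; apply: ler_sum => i ij.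
  have := z'z i; rewrite /ax (negbTE ij) mulr0 subr0 => zi; have vi := v'0 i.
  have wi := wmax i.
  have -> : (z' i - w i) ^+ 2 - (v' i - w i) ^+ 2 =
      (z' i - v' i) * (z' i + v' i - 2 * w i) by ring.
  apply: le_trans (ler_norm _) _; rewrite normrM; apply: ler_pM => //.
    by move: zi vi; rewrite !ler_norml; lra.
  by move: zi vi wi; rewrite !ler_norml; lra.
have : d%:R * (2 * eta * (2 * eta + 2 * t)) <= 1 / 2 * (2 * eta + 2 * t).
  by rewrite !mulrA ler_wpM2r //; lra.
by nra.
Qed.

End Perturbation.

Lemma connect_homo (T U : finType) (e : rel T) (e' : rel U) (f : T -> U) :
  {homo f : a b / e a b >-> e' a b} ->
  {homo f : a b / connect e a b >-> connect e' a b}.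
Proof.
move=> fe a b /connectP[p pe ->]; apply/connectP; exists (map f p).
  by rewrite (homo_path (e := e)).
by rewrite last_map.
Qed.

Lemma sqd_eq0 (R : realType) (d : nat) (p q : 'I_d -> R) :
  (sqd p q == 0) = (p == q).
Proof.
apply/eqP/eqP => [pq|->]; last exact: sqdxx.
apply/funext => j; apply/eqP; rewrite -subr_eq0 -sqrf_eq0 eq_le sqr_ge0 andbT.
by rewrite -pq sqr_le_sqd.
Qed.

(** The deterministic part of the argument. It is stated up to a translation [z] and a scale [s] so
    that one pattern serves all cells, and with a tolerance [eta] so that the pattern occurs with
    positive probability. *)
Lemma star_pattern (R : realType) (d k : nat) : (1 < d)%N -> (0 < k)%N ->
  (k <= strict_kissing_number R d)%N ->
  exists (I : finType) (c : I) (p : I -> 'I_d -> R) (eta M : R),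
  [/\ 0 < eta, forall a j, `|p a j| + eta <= M,
    forall a b r, (forall j, `|r j - p a j| <= eta) ->
      (forall j, `|r j - p b j| <= eta) -> a = b &
    forall n (x : 'I_n -> d.-tuple R) (f : I -> 'I_n) (z : 'I_d -> R) (s : R),
      0 < s -> injective f ->
      (forall a j, `|tnth (x (f a)) j - (z j + s * p a j)| <= s * eta) ->
      (forall i, i \notin codom f -> exists j, s * M < `|tnth (x i) j - z j|) ->
      degree (mst x) (f c) = k].
Proof.
move=> d1; case: k => // k _ kK.
have [u [u1 uu]] := strict_kissing_directions d1 kK.
have [zs [pz zs9 zsd]] := outward_walk_from_unit d1 (u1 ord0).
pose I : finType := option ('I_k.+1 + 'I_(size zs)).
pose z0 : 'I_d -> R := fun=> 0.
pose p (a : I) : 'I_d -> R := match a with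
  | None => z0 | Some (inl i) => u i | Some (inr t) => nth z0 zs t end.
pose D a b := sqd (p a) (p b).
pose c : I := None; pose y i : I := Some (inl i); pose sh t : I := Some (inr t).
have Dy i : D c (y i) = 1 by rewrite /D /= sqd0.
have Dsh t : 9 <= D c (sh t) by apply: zs9; rewrite mem_nth.
have Dyy i j : i != j -> 1 < D (y i) (y j) by exact: uu.
have Dysh i t : 1 < D (y i) (sh t).
  have := Dsh t; rewrite /D /= sqd0 sqdE u1; set q := nth _ _ _ => q9.
  (* Expanding the square of [q - 3 u] bounds twice the inner product of [q] and [u] by
     [|q|^2 / 3 + 3]; as [|q|^2 >= 9], the squared distance is at least 4. *)
  have := dot_ge0 (fun j => 1 * q j + (- 3) * u i j).
  rewrite dot_lincomb (dotC q) (dotC (u i)) !dot_lincomb (dotC q (u i)) u1; lra.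
have Dshsh t t' : t != t' -> 0 < D (sh t) (sh t').
  move=> tt'; rewrite lt_neqAle sqd_ge0 andbT eq_sym sqd_eq0 /=.
  (* Norms strictly increase along the walk, so its points are distinct. *)
  pose N (q : 'I_d -> R) := sqd z0 q.
  have srt : sorted (relpre N <%R) zs.
    apply: path_sorted (sub_path _ pz) => q r; rewrite /outward => /andP[_].
    exact.
  have lt_trans' : transitive (relpre N (<%R : rel R)).
    by move=> a b e; exact: lt_trans.
  have lt_nth := sorted_ltn_nth lt_trans' z0 srt.
  wlog ltt : t t' {tt'} / (t < t')%N => [hw|].
    case: (ltngtP t t') => [|h|/val_inj e]; first exact: hw.
      by rewrite eq_sym; apply: hw.
    by rewrite e eqxx in tt'.
  apply/eqP => e; have := lt_nth _ _ (ltn_ord t) (ltn_ord t') ltt.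
  by rewrite /relpre /= e ltxx.
have Dpos a b : a != b -> 0 < D a b.
  have Dsym a' b' : D a' b' = D b' a' by exact: sqd_sym.
  case: a b => [[i|t]|] [[j|t']|] // ne.
  - by apply: lt_trans (Dyy _ _ _).
  - by apply: lt_trans (Dysh _ _).
  - by rewrite Dsym Dy.
  - by rewrite Dsym; apply: lt_trans (Dysh _ _).
  - exact: Dshsh.
  - by rewrite Dsym; apply: lt_le_trans (Dsh _).
  - by rewrite Dy.
  - by apply: lt_le_trans (Dsh _).
have Dwalk t : connect [rel a b | D a b < D c (sh t)] c (sh t).
  (* The threshold is generalised to any [e] above the norm of the endpoint, so that the induction
     keeps it fixed while passing to earlier points. *)
  suff H m (mL : (m < size zs)%N) e : D c (sh (Ordinal mL)) <= e ->
      connect [rel a b | D a b < e] c (sh (Ordinal mL)).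
    case: t => m mL; exact: H.
  have /(pathP z0) step := pz.
  elim: m mL e => [|m IH] mL e De.
    apply: (@connect_trans _ _ (y ord0)); apply: connect1 => /=.
      by rewrite Dy; apply: lt_le_trans (le_trans (Dsh _) De); lra.
    by have /andP[h _] := step 0%N mL; exact: lt_le_trans De.
  have /andP[h1 h2] := step m.+1 mL.
  apply: connect_trans (IH (ltnW mL) e _) (connect1 _) => /=.
    by apply: le_trans De; apply: ltW.
  exact: lt_le_trans De.
have [K K3 pK0] := finite_upper_bound (fun t : I * 'I_d => `|p t.1 t.2|).
have pK a j : `|p a j| <= K by exact: pK0 (a, j).
have [eta eta0 [deta stable]] := sqd_order_stable (ltnW d1) K3 pK.
have dR : 1 <= d%:R :> R by rewrite ler1n ltnW.
have eta4 : eta <= 1 / 4 by nra.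
(* [T] bounds the squared distances within the perturbed pattern. With [M = T + K + 2], a point
   outside differs from each pattern point by more than [T + 1] in some coordinate, hence is farther
   away than any two pattern points are apart. *)
pose T := d%:R * (2 * K + 1) ^+ 2.
have T0 : 0 <= T by rewrite mulr_ge0 // sqr_ge0.
exists I, c, p, eta, (T + K + 2); split=> //.
- by move=> a j; have := pK a j; lra.
(* If [r] were within [eta] of two distinct pattern points, moving both to [r] would be an
   admissible perturbation that destroys the strict inequality [0 < D a b]. *)
- move=> a b r ra rb; apply/eqP; apply/negPn/negP => ab.
  pose p' e := if (e == a) || (e == b) then r else p e.
  have pp' e j : `|p' e j - p e j| <= eta.
    rewrite /p'; case: (eqVneq e a) => [->|_] /=; first exact: ra.
    by case: (eqVneq e b) => [->|_]; rewrite ?rb // subrr normr0 ltW.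
  have := stable p' pp' a a a b; rewrite sqdxx => /(_ (Dpos _ _ ab)).
  by rewrite /p' !eqxx orbT ltxx.
move=> n x f z s s0 finj xf xout.
pose q i j := (tnth (x i) j - z j) / s.
have xq i : tnth (x i) = fun j => z j + s * q i j.
  by apply/funext => j; rewrite /q mulrCA divff ?gt_eqF // mulr1 addrC subrK.
have ltE a b a' b' : (edist (x a) (x b) < edist (x a') (x b')) =
    (sqd (q a) (q b) < sqd (q a') (q b')).
  by rewrite edist_lt !xq !sqd_scale ltr_pM2l // exprn_gt0.
have qf a j : `|q (f a) j - p a j| <= eta.
  have := xf a j; rewrite xq opprD addrACA subrr add0r -mulrBr normrM (gtr0_norm s0).
  by rewrite ler_pM2l.
have qout i : i \notin codom f -> exists j, T + K + 2 < `|q i j|.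
  move=> /xout[j]; rewrite xq (addrC (z j)) addrK normrM (gtr0_norm s0) ltr_pM2l //.
  by exists j.
have ltf a b a' b' : D a b < D a' b' ->
    edist (x (f a)) (x (f b)) < edist (x (f a')) (x (f b')).
  by move=> h; rewrite ltE; exact: (stable (q \o f)).
have qK a j : `|q (f a) j| <= K + 1 / 4.
  by have := pK a j; have := qf a j; rewrite !ler_norml; lra.
have lt_out a b a' w : w \notin codom f ->
    edist (x (f a)) (x (f b)) < edist (x (f a')) (x w).
  move=> /qout[j wj]; rewrite ltE.
  apply: (@le_lt_trans _ _ T).
    apply: ler_sum_const => i; have := qK a i; have := qK b i.
    rewrite -[_ ^+ 2]real_normK ?num_real // => hb ha.
    rewrite ler_pXn2r ?nnegrE //; last lra.
    by apply: le_trans (ler_normB _ _) _; lra.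
  apply: lt_le_trans (sqr_le_sqd _ _ j).
  have h : T + 1 < `|q (f a') j - q w j|.
    by rewrite distrC; apply: lt_le_trans (lerB_dist _ _); have := qK a' j; lra.
  by rewrite -real_normK ?num_real //; nra.
pose Y := [set f (y i) | i in [set: 'I_k.+1]]%SET.
have fyI : injective (f \o y) by move=> i j /= /finj[].
have YP i : (i \in Y) = [exists j, i == f (y j)].
  by apply/imsetP/existsP => [[j _ ->]|[j /eqP->]]; exists j.
have fyY i : f (y i) \in Y by rewrite YP; apply/existsP; exists i.
have notY a : (forall i, a != y i) -> f a \notin Y.
  by move=> ay; rewrite YP; apply/existsPn => i; rewrite (inj_eq finj).
transitivity #|Y|; last by rewrite card_imset // finset.cardsT card_ord.
apply: (@mst_star_degree _ _ _ _ _ (f (y ord0))) => //.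
- exact: notY.
- move=> _ w /imsetP[i _ ->]; rewrite (inj_eq finj) => i0.
  have [/codomP[a ->]|wout _ _] := boolP (w \in codom f); last exact: lt_out.
  rewrite !(inj_eq finj) => ai ac; apply: ltf; rewrite /D sqd_sym -/(D _ _) Dy.
  case: a ai ac => [[j|t]|] // ji _; last exact: Dysh.
  by apply: Dyy; apply: contra ji => /eqP->.
- move=> a b aS bS ab.
  have [a' ea a'0] : exists2 a', a = f a' & a' = c \/ exists2 i, a' = y i & i != ord0.
    move: aS; rewrite !finset.inE => /orP[/eqP->|/andP[a0]]; first by exists c; [|left].
    move=> /imsetP[i _ ea]; exists (y i) => //; right; exists i => //.
    by apply: contraNneq a0 => i0; rewrite ea i0.
  have [/codomP[b' eb]|bout] := boolP (b \in codom f); last by rewrite ea; exact: lt_out.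
  move: bS ab; rewrite ea eb !finset.inE xpair_eqE !(inj_eq finj) negb_or.
  move=> /andP[bc by0] ab; apply: ltf; rewrite Dy.
  case: b' eb bc by0 ab => [[j|t]|] // _ _.
    rewrite fyY andbT negbK => /eqP -[->]; rewrite eqxx andbT => ac.
    by case: a'0 ac => [->//|[i -> i0] _]; exact: Dyy.
  move=> _ _; case: a'0 => [->|[i -> _]]; last exact: Dysh.
  by apply: lt_le_trans (Dsh _); lra.
move=> w wY wc; have [/codomP[a ea]|wout] := boolP (w \in codom f).
  case: a ea => [[i|t]|] ea; rewrite ea.
  - by move: wY; rewrite ea fyY.
  - by apply: connect_homo (Dwalk t) => a b; exact: ltf.
  - by move: wc; rewrite ea eqxx.
have [j wj] := qout w wout.
pose jm := [arg max_(i > j | true) `|q w i|]%O.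
have jmP i : `|q w i| <= `|q w jm| by rewrite /jm; case: arg_maxP => // l _; exact.
have [B B3 /(nthP z0)[m mL zB]] := zsd jm (q w jm < 0).
apply: (@connect_trans _ _ (f (sh (Ordinal mL)))); apply: connect1; first exact: lt_out.
rewrite /= ltE; apply: (@closer_to_axis_point _ _ eta B K jm (q w jm < 0)) => //.
- have := pK (sh (Ordinal mL)) jm; rewrite /= zB /ax eqxx mulr1 normrMsign.
  by rewrite ger0_norm //; lra.
- by have := jmP j; lra.
- by rewrite -normrEsign.
- by move=> i; have := qf c i; rewrite subr0.
- by move=> i; rewrite -zB; exact: (qf (sh (Ordinal mL))).
Qed.

(** * Patterns in the cells of a grid *)

Lemma uniform_prob_itv (R : realType) (a b : R) : 0 <= a -> a <= b -> b <= 1 ->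
  uniform_prob (@ltr01 R) `[a, b] = (b - a)%:E.
Proof.
move=> a0 ab b1; rewrite /uniform_prob.
rewrite (eq_integral (cst 1%E)); last first.
  move=> y; rewrite inE /= in_itv /= => /andP[ay yb].
  by rewrite /uniform_pdf (le_trans a0 ay) (le_trans yb b1) subr0 invr1.
rewrite integral_cst //= mul1e lebesgue_measure_itv /= lte_fin.
move: ab; rewrite le_eqVlt => /orP[/eqP->|ab]; last by rewrite ab.
by rewrite ltxx subrr.
Qed.

Section Box.
Variables (R : realType) (d : nat).

Definition box (c : 'I_d -> R) (r : R) : set (d.-tuple R) :=
  [set t | forall j, `|tnth t j - c j| <= r].

Lemma boxE (c : 'I_d -> R) (r : R) : box c r =
  [set t : d.-tuple R | forall j, `[c j - r, c j + r]%classic (tnth t j)].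
Proof.
by apply/seteqP; split=> t tc j; have := tc j; rewrite /= in_itv /= ler_distl.
Qed.

Lemma measurable_box (c : 'I_d -> R) (r : R) : measurable (box c r).
Proof.
rewrite boxE (_ : [set t | _] = \bigcap_(j in [set: 'I_d])
    ((fun t : d.-tuple R => tnth t j) @^-1` `[c j - r, c j + r]%classic)).
  apply: fin_bigcap_measurable => // j _.
  rewrite -[X in measurable X]setTI; apply: measurable_tnth => //.
by apply/seteqP; split=> t tc j => [_|]; apply: tc.
Qed.

Variables (dT : measure_display) (T : measurableType dT) (P : probability T R).

Lemma prob_box (X : {RV P >-> d.-tuple R}) (c : 'I_d -> R) (r : R) :
  uniform_on_cube X -> 0 <= r -> (forall j, 0 <= c j - r /\ c j + r <= 1) ->
  P (X @^-1` box c r) = ((2 * r) ^+ d)%:E.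
Proof.
move=> unifX r0 c01; rewrite boxE.
have := unifX (fun j => `[c j - r, c j + r]%classic) (fun j => measurable_itv _).
rewrite /distribution /= /pushforward => ->.
rewrite (eq_bigr (fun=> (2 * r)%:E)) => [|j _].
  by rewrite prodEFin prodr_const card_ord.
have [c0 c1] := c01 j; rewrite uniform_prob_itv //; last lra.
by congr EFin; ring.
Qed.

Lemma indep_finite (x : nat -> {RV P >-> d.-tuple R}) (n : nat)
    (B : 'I_n -> set (d.-tuple R)) :
  mutually_independent x -> (forall i, measurable (B i)) ->
  P [set w | forall i : 'I_n, B i (x i w)] =
  (\prod_(i < n) P (x i @^-1` B i))%E.
Proof.
move=> indx mB.
(* Independence is stated for events indexed by all of [nat]; past [n] the whole space is taken. *)
pose A m := if insub m is Some i then B i else setT.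
have AE (i : 'I_n) : A i = B i by rewrite /A valK.
have mA m : measurable (A m) by rewrite /A; case: insub.
pose J := [fset m in iota 0 n]%fset.
have inJ m : (m \in J) = (m < n)%N by rewrite in_fset /= mem_iota.
have -> : [set w | forall i : 'I_n, B i (x i w)] =
    \bigcap_(i in [set` J]) (x i @^-1` A i).
  apply/seteqP; split=> [w Bw m /=|w Aw i].
    by rewrite inJ => mn; have := Bw (Ordinal mn); rewrite -AE.
  by have := Aw i; rewrite /= inJ AE; apply.
rewrite indx //.
rewrite (perm_big (iota 0 n)) /=.
  by rewrite -[n in iota 0 n]subn0 big_mkord; apply: eq_bigr => i _; rewrite AE.
by apply: uniq_perm; rewrite ?fset_uniq ?iota_uniq // => m; rewrite inJ mem_iota.
Qed.

End Box.

Lemma bernoulli_inequality (R : realType) (v : R) (n : nat) :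
  0 <= v <= 1 -> 1 - n%:R * v <= (1 - v) ^+ n.
Proof.
move=> /andP[v0 v1]; elim: n => [|n IH]; first by rewrite expr0; lra.
rewrite exprS -natr1.
have : (1 - v) * (1 - n%:R * v) <= (1 - v) * (1 - v) ^+ n.
  by rewrite ler_wpM2l // subr_ge0.
have : 0 <= n%:R * v * v by rewrite !mulr_ge0.
lra.
Qed.

Lemma ffact_ge (R : realType) (n m : nat) : (2 * m <= n)%N ->
  (n%:R / 2) ^+ m <= (n ^_ m)%:R :> R.
Proof.
move=> mn; rewrite ffact_prod natr_prod -[m in X in X <= _]card_ord -prodr_const.
apply: ler_prod => i _; rewrite divr_ge0 //=.
have im := ltn_ord i; rewrite natrB; last lia.
have : (2 * i)%:R <= n%:R :> R by rewrite ler_nat; lia.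
rewrite natrM; lra.
Qed.

Section Cells.
Variables (R : realType) (d N : nat) (I : finType) (p : I -> 'I_d -> R).
Variables (eta M : R).
Hypotheses (N0 : (0 < N)%N) (M0 : 0 < M) (eta0 : 0 < eta).
Hypothesis pM : forall a j, `|p a j| + eta <= M.
Hypothesis psep : forall a b r, (forall j, `|r j - p a j| <= eta) ->
  (forall j, `|r j - p b j| <= eta) -> a = b.
Implicit Types q : {ffun 'I_d -> 'I_N}.

Let NR0 : 0 < N%:R :> R. Proof. by rewrite ltr0n. Qed.

Definition cell_center q (j : 'I_d) : R := ((q j)%:R + 1 / 2) / N%:R.

(* A cell has half-side [1 / (4 N)]: cells are disjoint, and a cell has volume
   at most [1 / (2 n)], so that Bernoulli's inequality bounds below the
   probability that it contains no point besides the pattern. *)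
Definition cell_scale : R := (4 * N%:R * M)^-1.

Definition cell q : set (d.-tuple R) := box (cell_center q) (cell_scale * M).

Definition spot q (a : I) : set (d.-tuple R) :=
  box (fun j => cell_center q j + cell_scale * p a j) (cell_scale * eta).

Lemma cell_scale_gt0 : 0 < cell_scale.
Proof. by rewrite invr_gt0 !mulr_gt0. Qed.

Lemma cell_scaleM : cell_scale * M = (4 * N%:R)^-1.
Proof. by rewrite /cell_scale invfM mulfVK // gt_eqF. Qed.

Lemma spot_sub_cell q a : spot q a `<=` cell q.
Proof.
have s0 := cell_scale_gt0.
move=> t ta j; have := ta j; have := pM a j; rewrite opprD addrA.
set y := tnth t j - _; set u := p a j; move=> uM yu.
have -> : y = (y - cell_scale * u) + cell_scale * u by rewrite subrK.
apply: le_trans (ler_normD _ _) _; rewrite normrM (gtr0_norm s0).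
apply: le_trans (lerD yu (lexx _)) _.
by rewrite -mulrDr ler_pM2l // addrC.
Qed.

Lemma cell_disjoint q q' t : cell q t -> cell q' t -> q = q'.
Proof.
move=> qt q't; apply/ffunP => j; apply/val_inj.
have := qt j; have := q't j; rewrite cell_scaleM !ler_distl.
rewrite /cell_center invfM.
have iN : 0 < N%:R^-1 :> R by rewrite invr_gt0.
set g := N%:R^-1 in iN *; set y := tnth t j => /andP[a1 a2] /andP[b1 b2].
have h1 : (q j)%:R < (q' j).+1%:R :> R.
  by rewrite -(ltr_pM2r iN) -natr1; nra.
have h2 : (q' j)%:R < (q j).+1%:R :> R.
  by rewrite -(ltr_pM2r iN) -natr1; nra.
by move: h1 h2; rewrite !ltr_nat !ltnS => h1 h2; apply/eqP; rewrite eqn_leq h1 h2.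
Qed.

Lemma spot_inj q a b t : spot q a t -> spot q b t -> a = b.
Proof.
have s0 := cell_scale_gt0.
have H c : spot q c t ->
    forall j, `|(tnth t j - cell_center q j) / cell_scale - p c j| <= eta.
  move=> tc j; rewrite -(ler_pM2l s0) -[X in X * `|_|](gtr0_norm s0) -normrM.
  by rewrite mulrBr mulrCA divff ?gt_eqF // mulr1 -addrA -opprD; exact: tc.
by move=> /H ta /H tb; exact: psep ta tb.
Qed.

Lemma cell_in_cube q j : 0 <= cell_center q j - cell_scale * M /\
  cell_center q j + cell_scale * M <= 1.
Proof.
rewrite cell_scaleM /cell_center invfM.
have iN : 0 < N%:R^-1 :> R by rewrite invr_gt0.
have : (q j).+1%:R <= N%:R :> R by rewrite ler_nat.
rewrite -(ler_pM2r iN) divff ?gt_eqF // -natr1.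
have : 0 <= (q j)%:R / N%:R :> R by rewrite divr_ge0.
set g := N%:R^-1 in iN *; set y := (q j)%:R => h1 h2.
split; nra.
Qed.

Lemma spot_in_cube q a j :
  0 <= cell_center q j + cell_scale * p a j - cell_scale * eta /\
  cell_center q j + cell_scale * p a j + cell_scale * eta <= 1.
Proof.
have s0 := cell_scale_gt0.
have [h1 h2] := cell_in_cube q j; have := pM a j.
rewrite -(ler_pM2l s0) mulrDr -[X in X * `|_|](gtr0_norm s0) -normrM => h3.
have := ler_norm (cell_scale * p a j).
have := ler_norm (- (cell_scale * p a j)); rewrite normrN; lra.
Qed.

Definition placements n : {set {ffun I -> 'I_n} * {ffun 'I_d -> 'I_N}} :=
  [set fq : {ffun I -> 'I_n} * {ffun 'I_d -> 'I_N} | injectiveb fq.1]%SET.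

(** [f] says which sample plays which role of the pattern, and [q] which cell hosts it. One
    constraint per sample makes the probability a product by independence. *)
Definition pattern_event n (f : {ffun I -> 'I_n}) q (i : 'I_n) :
    set (d.-tuple R) :=
  if [pick a | f a == i] is Some a then spot q a else ~` cell q.

Lemma measurable_pattern_event n (f : {ffun I -> 'I_n}) q i :
  measurable (pattern_event f q i).
Proof.
rewrite /pattern_event; case: pickP => [a _|_]; first exact: measurable_box.
by apply: measurableC; exact: measurable_box.
Qed.

Lemma pattern_eventP n (f : {ffun I -> 'I_n}) q (x : 'I_n -> d.-tuple R) :
  injective f ->
  (forall i, pattern_event f q i (x i)) ->
  (forall a, spot q a (x (f a))) /\
  (forall i, i \notin codom f -> ~ cell q (x i)).
Proof.
move=> finj xP; split=> [a|i ifN].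
  have := xP (f a); rewrite /pattern_event.
  by case: pickP => [b /eqP/finj->//|/(_ a)]; rewrite eqxx.
have := xP i; rewrite /pattern_event; case: pickP => [b /eqP fb|_ //].
by move: ifN; rewrite -fb codom_f.
Qed.

(** Distinct realised placements have distinct centres: the centre determines the cell, as cells are
    disjoint; the cell contains only pattern points, and the spots are disjoint, so the roles are
    determined too. *)
Lemma pattern_count k n (c : I) (x : 'I_n -> d.-tuple R) :
  (forall f : I -> 'I_n, forall (z : 'I_d -> R) (s : R),
      0 < s -> injective f ->
      (forall a j, `|tnth (x (f a)) j - (z j + s * p a j)| <= s * eta) ->
      (forall i, i \notin codom f -> exists j, s * M < `|tnth (x i) j - z j|) ->
      degree (mst x) (f c) = k) ->
  (#|[set fq in placements n |
     `[< forall i, pattern_event fq.1 fq.2 i (x i) >]]%SET| <= Lambda k x)%N.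
Proof.
move=> deg; set S := finset _.
have SP f q : (f, q) \in S -> [/\ injective f,
    forall a, spot q a (x (f a)) & forall i, i \notin codom f -> ~ cell q (x i)].
  rewrite !finset.inE /= => /andP[/injectiveP finj /asboolP].
  by move=> /(pattern_eventP finj)[? ?].
pose root (fq : {ffun I -> 'I_n} * {ffun 'I_d -> 'I_N}) := fq.1 c.
have rootI : {in S &, injective root}.
  move=> [f q] [f' q'] /SP[finj fin fout] /SP[f'inj f'in f'out]; rewrite /root /= => ff'.
  have qq' : q = q'.
    apply: (@cell_disjoint _ _ (x (f c))); first exact/spot_sub_cell/fin.
    by rewrite ff'; exact/spot_sub_cell/f'in.
  subst q'; congr pair; apply/ffunP => a.
  have [/codomP[b f'a]|/fout[]] := boolP (f' a \in codom f); last exact/spot_sub_cell/f'in.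
  rewrite f'a; congr (f _); apply: (@spot_inj q _ _ (x (f' a))); first exact: f'in.
  by rewrite f'a; exact: fin.
rewrite -(card_in_imset rootI) /Lambda; apply/subset_leq_card/fintype.subsetP => v.
move=> /imsetP[[f q] /SP[finj fin fout] ->]; rewrite finset.inE; apply/eqP.
apply: (deg f (cell_center q) cell_scale cell_scale_gt0 finj) => [a j|i /fout xi].
  exact: fin.
apply/not_existsP => h; apply: xi => j; rewrite leNgt; apply/negP; exact: h.
Qed.

Variables (dT : measure_display) (T : measurableType dT) (P : probability T R).
Variable x : nat -> {RV P >-> d.-tuple R}.
Hypotheses (unifx : forall i, uniform_on_cube (x i)).
Hypothesis indx : mutually_independent x.

Lemma prob_pattern n (f : {ffun I -> 'I_n}) q : injective f ->
  P [set w | forall i : 'I_n, pattern_event f q i (x i w)] =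
  (((2 * (cell_scale * eta)) ^+ d) ^+ #|I| *
   (1 - (2 * (cell_scale * M)) ^+ d) ^+ (n - #|I|))%:E.
Proof.
have s0 := cell_scale_gt0.
move=> finj; rewrite indep_finite //; last exact: measurable_pattern_event.
set A := _ ^+ d; set B := 1 - _.
rewrite (eq_bigr (fun i => (if i \in codom f then A else B)%:E)) => [|i _].
  rewrite prodEFin (bigID [in codom f]) /=; congr EFin; congr (_ * _).
    rewrite (eq_bigr (fun=> A)) => [|i ->//].
    by rewrite prodr_const card_codom.
  rewrite (eq_bigr (fun=> B)) => [|i /negbTE->//].
  rewrite prodr_const; congr (_ ^+ _).
  have := cardC [in codom f]; rewrite card_ord card_codom // => h.
  by rewrite -[LHS](addKn #|I|); congr subn.
rewrite /pattern_event; case: pickP => [a /eqP <-|fi].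
  rewrite codom_f prob_box //; first by rewrite mulr_ge0 // ltW.
  exact: spot_in_cube.
rewrite ifN; last by apply/codomP => -[a ia]; have := fi a; rewrite ia eqxx.
rewrite -preimage_setC probability_setC; last by apply: measurable_funPTI; exact: measurable_box.
rewrite prob_box //; first by rewrite mulr_ge0 // ltW.
exact: cell_in_cube.
Qed.

(** There are [n ^_ m * n] placements, each of probability [(c / n)^m * (1 - V)^(n - m)]. The
    falling factorial is at least [(n / 2)^m], which cancels the powers of [n], and the last factor
    is at least [1 / 2] because [n V = 2^-d]. The sum is thus at least linear in [n]. *)
Lemma prob_pattern_sum_ge n :
  (0 < d)%N -> n = (N ^ d)%N -> (2 * #|I| <= n)%N ->
  ((n%:R * (((eta / (2 * M)) ^+ d / 2) ^+ #|I| / 2))%:E <=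
   \sum_(fq in placements n) P [set w | forall i : 'I_n,
     pattern_event fq.1 fq.2 i (x i w)])%E.
Proof.
move=> d0 nN In; set m := #|I|; set c := _ ^+ d.
pose V : R := (2 * (cell_scale * M)) ^+ d.
pose A : R := (2 * (cell_scale * eta)) ^+ d.
rewrite (eq_bigr (fun=> (A ^+ m * (1 - V) ^+ (n - m))%:E)); last first.
  by move=> [f q]; rewrite finset.inE => /injectiveP finj; exact: prob_pattern.
have n0 : 0 < n%:R :> R by rewrite nN ltr0n expn_gt0 N0.
have AE : A = c / n%:R.
  rewrite /A /c nN natrX -expr_div_n /cell_scale; congr (_ ^+ _).
  by field; rewrite !gt_eqF.
have VE : V = 2 ^- d / n%:R.
  rewrite /V cell_scaleM nN natrX -exprVn -expr_div_n; congr (_ ^+ _).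
  by field; rewrite gt_eqF.
have half : 2 ^- d <= 1 / 2 :> R.
  rewrite mul1r lef_pV2 ?posrE ?exprn_gt0 // -[leLHS]expr1.
  by rewrite ler_eXn2l // ltr1n.
have nV : n%:R * V <= 1 / 2 by rewrite VE mulrCA divff ?gt_eqF // mulr1.
have V0 : 0 <= V by rewrite VE divr_ge0 // ltW.
have V1 : V <= 1.
  have : 1 <= n%:R :> R by rewrite ler1n -(ltr0n R).
  nra.
have hV : 1 / 2 <= (1 - V) ^+ (n - m).
  have h : 1 - n%:R * V <= (1 - V) ^+ n by apply: bernoulli_inequality; rewrite V0.
  apply: (@le_trans _ _ ((1 - V) ^+ n)); first by lra.
  by apply: ler_wiXn2l; rewrite ?leq_subr //; lra.
have cS : #|placements n| = (n ^_ m * n)%N.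
  transitivity #|finset.setX [set f : {ffun I -> 'I_n} | injectiveb f]
                      [set: {ffun 'I_d -> 'I_N}]|%SET.
    by apply: eq_card => -[f q]; rewrite finset.in_setX !finset.inE andbT.
  by rewrite cardsX card_inj_ffuns finset.cardsT card_ffun !card_ord nN.
rewrite sumEFin lee_fin sumr_const cS -[leRHS]mulr_natr natrM [leLHS]mulrC -[leRHS]mulrA.
have c0 : 0 <= c by rewrite exprn_ge0 // divr_ge0 // ?mulr_ge0 // ltW.
have -> : (c / 2) ^+ m / 2 * n%:R = (c / n%:R) ^+ m * (1 / 2 * ((n%:R / 2) ^+ m * n%:R)).
  rewrite (_ : c / 2 = c / n%:R * (n%:R / 2)) ?exprMn; first by ring.
  by field; rewrite gt_eqF.
have cn0 : 0 <= c / n%:R by rewrite divr_ge0 // ltW.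
rewrite AE; apply: ler_wpM2l; first exact: exprn_ge0.
apply: ler_pM; [by rewrite divr_ge0| |exact: hV|].
  by rewrite mulr_ge0 ?exprn_ge0 ?divr_ge0.
by apply: ler_wpM2r => //; exact: ffact_ge.
Qed.

End Cells.

(** * Expectation bound and passage to the limit *)

Theorem theorem1p1 (R : realType) (d k : nat)
    (hd : (2 <= d)%N) (hk1 : (1 <= k)%N)
    (hk : (k <= strict_kissing_number R d)%N)
    (dT : measure_display) (T : measurableType dT) (P : probability T R)
    (x : nat -> {RV P >-> d.-tuple R})
    (hunif : forall i, uniform_on_cube (x i))
    (hindep : mutually_independent x)
    (alpha : R)
    (halpha : {ae P, forall w,
      (fun n : nat => (Lambda k (fun i : 'I_n => x i w))%:R / n%:R : R)
        @ \oo --> alpha}) :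
  0 < alpha.
Proof.
have [I [c [p [eta [M [eta0 pM psep deg]]]]]] := star_pattern hd hk1 hk.
have d0 : (0 < d)%N by exact: ltnW.
have M0 : 0 < M.
  by have := pM c (Ordinal d0); have := normr_ge0 (p c (Ordinal d0)); lra.
set m := #|I|.
pose kappa : R := ((eta / (2 * M)) ^+ d / 2) ^+ m / 2.
have kappa0 : 0 < kappa by rewrite !(divr_gt0, exprn_gt0) // mulr_gt0.
(* The shift by [2 m] guarantees [2 m <= size_ i], as [prob_pattern_sum_ge] requires, for every
   [i]. *)
pose side i := (i + 2 * m).+1.
pose size_ i := (side i ^ d)%N.
have size_ge i : (side i <= size_ i)%N.
  by rewrite /size_ -[leqLHS]expn1 leq_pexp2l.
have size_gt0 i : 0 < (size_ i)%:R :> R.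
  by rewrite ltr0n; exact: leq_trans (size_ge i).
pose pat i := placements d (side i) I (size_ i).
pose A i (fq : {ffun I -> 'I_(size_ i)} * {ffun 'I_d -> 'I_(side i)}) : set T :=
  [set w | forall l : 'I_(size_ i), pattern_event p eta M fq.1 fq.2 l (x l w)].
have mA i fq : measurable (A i fq).
  rewrite (_ : A i fq = \bigcap_(l in [set: 'I_(size_ i)])
      (x l @^-1` pattern_event p eta M fq.1 fq.2 l)).
    apply: fin_bigcap_measurable => // l _; apply: measurable_funPTI.
    exact: measurable_pattern_event.
  by apply/seteqP; split=> w Aw l => [_|]; exact: Aw.
pose G i w : R := \sum_(fq <- enum (pat i)) \1_(A i fq) w.
pose L i w := Lambda k (fun l : 'I_(size_ i) => x l w).
have G_ge0 i w : 0 <= G i w by apply: sumr_ge0 => fq _; rewrite indicE.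
have G_le i w : G i w <= (L i w)%:R.
  apply: le_trans (_ : _ <= (#|[set fq in pat i | `[< A i fq w >]]%SET|)%:R) _.
    rewrite /G big_enum /= -sum1_card natr_sum.
    rewrite [leRHS](eq_bigl (fun fq => (fq \in pat i) && `[< A i fq w >])).
      rewrite big_mkcondr /=; apply: ler_sum => fq _; rewrite indicE.
      by case: ifPn => /asboolP h; [rewrite mem_set|rewrite memNset].
    by move=> fq; rewrite finset.inE.
  rewrite ler_nat.
  by apply: (pattern_count (isT : (0 < side i)%N) M0 pM psep
    (x := fun l : 'I_(size_ i) => x l w)) => f z s; exact: deg.
have L_le i w : (L i w)%:R <= (size_ i)%:R :> R.
  by rewrite ler_nat /L /Lambda -[leqRHS]card_ord max_card.
pose f_ i w : \bar R := (G i w / (size_ i)%:R)%:E.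
have mf_ i : measurable_fun setT (f_ i).
  apply/measurable_EFinP; apply: measurable_funM => //.
  by apply: measurable_sum => fq; exact: measurable_indic.
have int_f i : (kappa%:E <= \int[P]_w f_ i w)%E.
  rewrite /f_; under eq_integral do rewrite mulrC EFinM -sumEFin.
  have mI fq : measurable_fun setT (fun w => (\1_(A i fq) w)%:E : \bar R).
    by apply/measurable_EFinP; exact: measurable_indic.
  rewrite ge0_integralZl_EFin //.
  - rewrite ge0_integral_sum // big_enum /=.
    rewrite (eq_bigr (fun fq => P (A i fq))) => [|fq _]; last first.
      by rewrite integral_indic // setIT.
    have h := prob_pattern_sum_ge (isT : (0 < side i)%N) M0 eta0 pM hunif hindep d0
      (erefl (size_ i)) _.
    rewrite -lee_pdivrMl ?invr_gt0 // invrK -EFinM; apply: h.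
    by apply: leq_trans (size_ge i); rewrite /side; lia.
  - by move=> w _; apply: sume_ge0 => fq _; rewrite lee_fin indicE.
  - exact: emeasurable_sum.
rewrite ltNge; apply/negP => alpha_le0.
have size_oo : size_ i @[i --> \oo] --> \oo.
  apply/cvgnyPge => B; near=> i; apply: leq_trans (size_ge i).
  have : (B <= i)%N by near: i; exact: nbhs_infty_ge.
  by rewrite /side; lia.
have f_le i w : G i w / (size_ i)%:R <= (L i w)%:R / (size_ i)%:R.
  by apply: ler_wpM2r => //; rewrite invr_ge0 ltW.
(* If [alpha <= 0], then [alpha = 0] by nonnegativity, and [f_ i], squeezed between 0 and
   [L i / size_ i], tends to 0 almost everywhere. It is bounded by 1, so its integrals tend to 0,
   although each is at least [kappa]. *)
have [||||_ _] := @dominated_convergence _ _ _ P setT measurableT f_ (cst 0%E) (cst 1%E) mf_.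
- exact: measurable_cst.
- apply: filterS halpha => w hw _; apply: cvg_EFin; first exact: nearW.
  have cvL : (L i w)%:R / (size_ i)%:R @[i --> \oo] --> alpha.
    exact: cvg_comp size_oo hw.
  have alpha0 : alpha = 0.
    apply/eqP; rewrite eq_le alpha_le0 /=; apply: (ler_cvg_to (cvg_cst 0) cvL).
    by apply: nearW => i; rewrite divr_ge0.
  apply: (squeeze_cvgr _ (cvg_cst 0)); last by rewrite alpha0 in cvL; exact: cvL.
  by apply: nearW => i; rewrite /= f_le andbT divr_ge0 // ltW.
- exact: finite_measure_integrable_cst.
- apply: aeW => w i _; have f0 : (0 <= f_ i w)%E by rewrite lee_fin divr_ge0 // ltW.
  rewrite (gee0_abs f0) lee_fin (le_trans (f_le i w)) //.
  by rewrite ler_pdivrMr // mul1r L_le.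
rewrite integral0 => f_cvg; have : (kappa%:E <= 0)%E.
  by apply: (cvge_to_ge f_cvg); apply: nearW => i; exact: int_f.
by rewrite lee_fin leNgt kappa0.
Unshelve. all: by end_near.
Qed.
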